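(* For every $\delta\ge 0$ there is a constant $M$, depending only on $\delta$, such that the following holds. Let $G$ be a group, $K<G$ a subgroup, and $X\subset G$ a symmetric relative generating set of $G$ with respect to $K$, and assume that the Cayley graph $\Gamma(G,K\sqcup X)$ is $\delta$-hyperbolic. Let $\varphi\in Q_{as}(K)$. If $\varphi$ is $(G,X)$-controlled, then $\varphi$ extends to a quasimorphism $\Phi\in Q_{as}(G)$ (i.e. $\Phi|_K=\varphi$). Moreover, if $\varphi$ is linearly $(G,X)$-controlled with a constant $C_0>0$, then the extension $\Phi\in Q_{as}(G)$ can be chosen so that $D(\Phi)\le MC_0+MD(\varphi)$.
   Context: A quasimorphism on a group $G$ is a function $\varphi:G\to\mathbb R$ with finite defect $D(\varphi):=\sup_{g,h\in G}|\varphi(g)+\varphi(h)-\varphi(gh)|$. It is antisymmetric if $\varphi(g^{-1})=-\varphi(g)$ for all $g$; $Q_{as}(G)$ is the set of antisymmetric quasimorphisms on $G$. A relative generating set of $G$ with respect to $K$ is a subset $X\subset G$ such that $K\cup X$ generates $G$. $\Gamma(G,K\sqcup X)$ is the Cayley graph of $G$ with respect to $K\sqcup X$ (edges of length 1). Let $F(X)$ be the free group with basis $X$. Every $a\in K*F(X)$ has a unique shortest expression (its normal form) as a word in letters from $K\setminus\{1\}$ and $X\cup X^{-1}$; $|a|$ is the length of this word. Let $\theta:K*F(X)\to G$ be the natural projection and let $\eta:K*F(X)\to K$ be the homomorphism that is the identity on $K$ and sends every $x\in X$ to $1$. For a quasimorphism $\varphi$ on $K$ put $\tilde\varphi:=\varphi\circ\eta$,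 i.e. $\tilde\varphi(a)=\varphi(\prod_i k_i)$, where the $k_i$ are the $K$-letters of the normal form of $a$ in order. $\varphi$ is $(G,X)$-controlled by a function $f:\mathbb N\to\mathbb R$ if $|\tilde\varphi(a)|\le f(n)$ for every $n$ and every $a\in\ker(\theta)$ with $|a|\le n$. It is $(G,X)$-controlled if it is so by some $f$, and linearly $(G,X)$-controlled with a constant $C_0$ if it is so by $f(n)=C_0n+C_0$. *)

(* Defs.v *)
From HB Require Import structures.
From mathcomp Require Import all_boot all_order all_algebra.
From mathcomp Require Import boolp classical_sets reals.
Set Implicit Arguments.
Unset Strict Implicit.
Unset Printing Implicit Defensive.
Import Order.TTheory GRing.Theory Num.Theory.

Section Letters.
Local Open Scope group_scope.
Variables (K : groupType) (X : choiceType).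

(* The letters of K * F(X): [inl k] is k : K; [inr (x, false)] and
   [inr (x, true)] are the basis element x and its formal inverse.  When X is a
   subset of a group, the formal inverse of x is not the basis element x^-1. *)
Definition letter : Type := (K + X * bool)%type.

Implicit Types (l : letter) (w : seq letter).

Definition inv_letter l : letter :=
  match l with inl k => inl k^-1 | inr (x, e) => inr (x, ~~ e) end.

Definition nontrivial_letter l : bool := if l is inl k then k != 1 else true.

Definition irreducible_pair l1 l2 : bool :=
  match l1, l2 with
  | inl _, inl _ => false
  | inr (x, e), inr (y, e') => ~~ ((x == y) && (e != e'))
  | _, _ => true
  end.

Definition normal w : bool :=
  all nontrivial_letter w && sorted irreducible_pair w.

Arguments normal : simpl never.

(* Left multiplication of a normal form by one letter. *)
Definition push l w : seq letter :=
  match l, w with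
  | inl k, inl k' :: w' =>
      if k * k' == 1 then w' else inl (k * k') :: w'
  | inl k, _ => if k == 1 then w else inl k :: w
  | inr (x, e), inr (y, e') :: w' =>
      if (x == y) && (e != e') then w' else l :: w
  | inr _, _ => l :: w
  end.

Lemma normal_cons l w :
  normal (l :: w) =
  [&& nontrivial_letter l, (if w is l' :: _ then irreducible_pair l l' else true)
    & normal w].
Proof.
rewrite /normal /=; case: w => [|l' w] /=; first by rewrite !andbT.
by case: nontrivial_letter; case: irreducible_pair; rewrite //= ?andbF.
Qed.

Lemma push_cons l w : normal (l :: w) -> push l w = l :: w.
Proof.
rewrite normal_cons; case: l => [k|[x e]]; case: w => [|[k'|[y e']] w] //=.
- by rewrite !andbT => /negbTE->.
- by rewrite andbF.
- by move=> /andP[/negbTE->].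
- by move=> /andP[/negbTE->].
Qed.

Lemma normal_push l w : normal w -> normal (push l w).
Proof.
case: l => [k|[x e]]; case: w => [|[k'|[y e']] w] //=.
- by case: (altP (k =P 1)) => // k1 _; rewrite normal_cons /= k1.
- case: ifPn => [_|kk']; rewrite !normal_cons /=; first by case/and3P.
  by case/and3P => _ -> ->; rewrite kk'.
- by case: (altP (k =P 1)) => // k1 nw; rewrite normal_cons /= k1.
- case: ifPn => [_|xy] nw; first by move: nw; rewrite normal_cons => /and3P[].
  by rewrite normal_cons /= xy.
Qed.

Lemma push1 w : normal w -> push (inl 1) w = w.
Proof.
case: w => [|[k|[y e]] w] //=; rewrite ?eqxx // mul1g.
by rewrite normal_cons /= => /andP[/negbTE->].
Qed.

Lemma pushM k k' w : normal w ->
  push (inl k) (push (inl k') w) = push (inl (k * k')) w.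
Proof.
have aux v : (if v is inl _ :: _ then false else true) ->
    push (inl k) (push (inl k') v) = push (inl (k * k')) v.
  case: v => [|[//|[y e]] v] _ /=.
    by case: eqP => [->|_] /=; rewrite ?mulg1.
  by case: eqP => [->|_] /=; rewrite ?mulg1.
case: w => [|[h|[y e]] w]; [by move=> _; exact: aux| |by move=> _; exact: aux].
rewrite normal_cons /= => /and3P[h1 hw nw].
case: (altP (k' * h =P 1)) => [k'h|k'h] /=; last by rewrite mulgA.
rewrite -mulgA k'h mulg1.
by case: w hw nw => [|[//|[y e]] w].
Qed.

Lemma pushK x e w : normal w ->
  push (inr (x, e)) (push (inr (x, ~~ e)) w) = w.
Proof.
case: w => [|[h|[y e']] w] nw /=; rewrite ?eqxx /= ?neq_sym.
- by case: e.
- by case: e.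
case: ifPn => [/andP[/eqP-> ee']|_] /=; last by rewrite eqxx; case: (e).
have -> : e = e' by move: ee'; case: (e); case: (e').
exact: (push_cons nw).
Qed.

Lemma pushVK l w : normal w -> push (inv_letter l) (push l w) = w.
Proof.
case: l => [k|[x e]] nw; rewrite /inv_letter.
  by rewrite pushM // mulVg push1.
by have := pushK x (~~ e) nw; rewrite negbK.
Qed.

Definition mulw w w' : seq letter := foldr push w' w.

Lemma normal_mulw w w' : normal w' -> normal (mulw w w').
Proof. by move=> nw'; elim: w => //= l w IHw; exact: normal_push. Qed.

Lemma mulw0 w : normal w -> mulw w [::] = w.
Proof.
elim: w => //= l w IHw nlw; rewrite IHw ?push_cons //.
by move: nlw; rewrite normal_cons => /and3P[].
Qed.

Lemma mulw_push l w w' : normal w -> normal w' ->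
  mulw (push l w) w' = push l (mulw w w').
Proof.
move=> nw nw'.
have mc l' v : mulw (l' :: v) w' = push l' (mulw v w') by [].
have nm v : normal (mulw v w') by exact: normal_mulw.
case: l => [k|[x e]]; case: w nw => [|[h|[y e']] w] nw; rewrite [push _ _ in LHS]/=.
- by case: eqP => [->|_]; rewrite ?mc ?push1.
- by case: eqP => [kh|_]; rewrite !mc pushM // kh push1.
- by case: eqP => [->|_]; rewrite ?mc ?push1 // -mc.
- by [].
- by [].
- case: ifP => [/andP[/eqP<- ee']|] //; rewrite mc.
  have -> : e' = ~~ e by move: ee'; case: (e); case: (e').
  by rewrite pushK.
Qed.

Lemma mulwA w1 w2 w3 : normal w2 -> normal w3 ->
  mulw w1 (mulw w2 w3) = mulw (mulw w1 w2) w3.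
Proof.
move=> n2 n3; elim: w1 => //= l w IHw.
by rewrite IHw mulw_push // normal_mulw.
Qed.

Definition invw w : seq letter := rev (map inv_letter w).

Lemma inv_letterK : involutive inv_letter.
Proof. by case=> [k|[x e]] /=; rewrite ?invgK ?negbK. Qed.

Lemma invwK : involutive invw.
Proof. by move=> w; rewrite /invw map_rev revK mapK //; exact: inv_letterK. Qed.

Lemma normal_invw w : normal w -> normal (invw w).
Proof.
rewrite /normal /invw all_rev rev_sorted all_map sorted_map => /andP[aw sw].
apply/andP; split.
  by apply: sub_all aw => -[k|[]] //=; rewrite invg_eq1.
apply: sub_sorted sw => -[k|[x e]] [k'|[y e']] //=.
by rewrite eq_sym; case: e; case: e'.
Qed.

Lemma mulVw w : normal w -> mulw (invw w) w = [::].
Proof.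
elim: w => //= l w IHw nlw.
have nw : normal w by move: nlw; rewrite normal_cons => /and3P[].
rewrite /mulw /invw /= rev_cons foldr_rcons -[in X in foldr _ X](push_cons nlw).
by rewrite pushVK //; exact: IHw.
Qed.

End Letters.

(* The free product K * F(X), realized on the normal forms of its elements. *)
Record freeprod (K : groupType) (X : choiceType) : Type := FreeProd {
  nform : seq (letter K X);
  nformP : normal nform
}.

HB.instance Definition _ K X := [isSub for @nform K X].
HB.instance Definition _ K X := [Choice of freeprod K X by <:].

Section FreeProductGroup.
Variables (K : groupType) (X : choiceType).
Implicit Types a b c : freeprod K X.

Definition fp_one : freeprod K X := @FreeProd K X [::] isT.
Definition fp_mul a b : freeprod K X :=
  FreeProd (normal_mulw (nform a) (nformP b)).
Definition fp_inv a : freeprod K X := FreeProd (normal_invw (nformP a)).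

Lemma fp_mulA : associative fp_mul.
Proof. by move=> a b c; apply: val_inj; rewrite /= mulwA // nformP. Qed.
Lemma fp_mul1 : left_id fp_one fp_mul.
Proof. by move=> a; apply: val_inj. Qed.
Lemma fp_mulr1 : right_id fp_one fp_mul.
Proof. by move=> a; apply: val_inj; rewrite /= mulw0 // nformP. Qed.
Lemma fp_mulV : left_inverse fp_one fp_inv fp_mul.
Proof. by move=> a; apply: val_inj; rewrite /= mulVw // nformP. Qed.
Lemma fp_mulVr : right_inverse fp_one fp_inv fp_mul.
Proof.
move=> a; apply: val_inj; rewrite /= -[X in mulw X]invwK mulVw //.
exact: normal_invw (nformP a).
Qed.

HB.instance Definition _ := isGroup.Build (freeprod K X)
  fp_mulA fp_mul1 fp_mulr1 fp_mulV fp_mulVr.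

Definition fp_length a : nat := size (nform a).

(* The map K * F(X) -> H that is f on K and h on X. *)
Definition eval_letter (H : groupType) (f : K -> H) (h : X -> H)
    (l : letter K X) : H :=
  match l with inl k => f k | inr (x, e) => if e then (h x)^-1 else h x end%g.

Definition fp_lift (H : groupType) (f : K -> H) (h : X -> H) a : H :=
  (\prod_(l <- nform a) eval_letter f h l)%g.

Lemma fp_lift_morphism (H : groupType) (f : K -> H) (h : X -> H) :
  {morph f : x y / (x * y)%g} -> {morph fp_lift f h : a b / (a * b)%g}.
Proof.
move=> fM.
have f1 : f 1%g = 1%g by apply: (mulgI (f 1%g)); rewrite -fM !mulg1.
have evp l w : (\prod_(l' <- push l w) eval_letter f h l' =
    eval_letter f h l * \prod_(l' <- w) eval_letter f h l')%g.
  case: l => [k|[x e]]; case: w => [|[k'|[y e']] w] /=.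
  - by case: eqP => [->|_]; rewrite ?big_cons ?big_nil ?f1 ?mulg1.
  - case: eqP => [kk'|_]; rewrite !big_cons /= ?fM ?mulgA //.
    by rewrite -fM kk' f1 mul1g.
  - by case: eqP => [->|_]; rewrite !big_cons /= ?f1 ?mul1g.
  - by rewrite big_cons.
  - by rewrite big_cons.
  - case: ifP => [/andP[/eqP<- ee']|_]; rewrite !big_cons //= mulgA.
    by case: e e' ee' => [] [] //= _; rewrite ?mulVg ?mulgV mul1g.
move=> a b; rewrite /fp_lift /= /mulw.
elim: (nform a) => [|l w IHw] /=; first by rewrite big_nil mul1g.
by rewrite evp IHw big_cons mulgA.
Qed.

End FreeProductGroup.

Section Quasimorphisms.
Local Open Scope classical_set_scope.
Local Open Scope ring_scope.
Variables (R : realType) (G : groupType).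
Implicit Type phi : G -> R.

Definition defect_set phi : set R :=
  [set `|phi gh.1 + phi gh.2 - phi (gh.1 * gh.2)%g| | gh in [set: G * G]].

Definition quasimorphism phi : Prop := has_ubound (defect_set phi).

(* Meaningful only when [quasimorphism phi]: [sup] is 0 on unbounded sets. *)
Definition defect phi : R := sup (defect_set phi).

Definition Qas : set (G -> R) :=
  [set phi | quasimorphism phi /\ forall g, phi (g^-1)%g = - phi g].

End Quasimorphisms.

Arguments Qas : clear implicits.

Section Hyperbolicity.
Local Open Scope ring_scope.
(* [d] may be a pseudometric: endpoints are only matched up to distance 0, so
   that the notions below are those of the quotient metric space. *)
Variables (R : realType) (T : Type) (d : T -> T -> R).

Definition geodesic (x y : T) (L : R) (c : R -> T) : Prop :=
  [/\ 0 <= L, d x (c 0) = 0, d (c L) y = 0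
    & forall s t, 0 <= s <= L -> 0 <= t <= L -> d (c s) (c t) = `|s - t|].

Definition near_side (delta : R) (p : T) (L : R) (c : R -> T) : Prop :=
  exists2 s, 0 <= s <= L & d p (c s) <= delta.

(* All geodesic triangles are delta-slim; for the two other sides of a triangle
   permute x, y, z cyclically. *)
Definition hyperbolic (delta : R) : Prop :=
  forall (x y z : T) (L1 L2 L3 : R) (c1 c2 c3 : R -> T),
    geodesic x y L1 c1 -> geodesic y z L2 c2 -> geodesic z x L3 c3 ->
  forall t, 0 <= t <= L1 ->
    near_side delta (c1 t) L2 c2 \/ near_side delta (c1 t) L3 c3.

End Hyperbolicity.

Section Relative.
Local Open Scope classical_set_scope.
Local Open Scope ring_scope.
Variables (R : realType) (G : groupType) (S : pred G) (K : subGroupType S).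
Variable X : set G.

Definition symmetric_set : Prop := forall x, X x -> X (x^-1)%g.

(* The only subgroup of G containing K and X is G itself. *)
Definition relative_generating_set : Prop :=
  forall H : groupClosed G,
    (forall k : K, val k \in H) -> (forall x, X x -> x \in H) ->
  forall g, g \in H.

(* The alphabet of the Cayley graph; a disjoint union, so an element of both K
   and X labels two different edges at each vertex. *)
Definition alphabet : Type := (K + X)%type.

Definition alphabet_val (a : alphabet) : G :=
  match a with inl k => val k | inr x => val x end.

Definition opposite (a b : alphabet) : Prop :=
  match a, b with
  | inl k, inl k' => k' = (k^-1)%g
  | inr x, inr y => val y = ((val x)^-1)%g
  | _, _ => False
  end.

(* Combinatorial distance between vertices; K and X being symmetric, an edge
   path is a word in the alphabet. *)
Definition vertex_dist (g h : G) : R :=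
  inf [set (size w)%:R | w in
        [set w : seq alphabet | (g * \prod_(a <- w) alphabet_val a)%g = h]].

(* A point of the Cayley graph: on the edge from g to g * a, at distance t from
   g.  Loops (a = 1) are left out.  The edge (g * a, a^-1) is (g, a) with the
   reverse orientation; the identifications of points are made by [cayley_dist]
   being 0. *)
Record cayley_point : Type := CayleyPoint {
  cp_base : G;
  cp_label : alphabet;
  cp_pos : R;
  cp_not_loop : alphabet_val cp_label <> 1%g;
  cp_pos_bounds : 0 <= cp_pos <= 1
}.

Implicit Types p q : cayley_point.

Definition cp_tip p : G := (cp_base p * alphabet_val (cp_label p))%g.

(* The two ends of the edge of p, and the distances of p to them. *)
Definition cp_end p (e : bool) : G := if e then cp_tip p else cp_base p.
Definition cp_off p (e : bool) : R := if e then 1 - cp_pos p else cp_pos p.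

(* The length metric with edges of length 1: the least length of a path from p
   to q, passing through vertices or inside a common edge. *)
Definition cayley_dist p q : R :=
  inf ([set cp_off p i.1 + vertex_dist (cp_end p i.1) (cp_end q i.2)
            + cp_off q i.2 | i in [set: bool * bool]]
   `|` [set r : R | [/\ cp_base q = cp_base p, cp_label q = cp_label p
                  & r = `|cp_pos p - cp_pos q|]]
   `|` [set r : R | [/\ cp_base q = cp_tip p, opposite (cp_label p) (cp_label q)
                  & r = `|cp_pos p - (1 - cp_pos q)|]]).

Definition theta : freeprod K X -> G :=
  @fp_lift K X G (val : K -> G) (val : X -> G).

Definition eta : freeprod K X -> K := @fp_lift K X K id (fun=> 1%g).

Definition controlled_by (phi : K -> R) (f : nat -> R) : Prop :=
  forall (n : nat) (a : freeprod K X),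
    theta a = 1%g -> (fp_length a <= n)%N -> `|phi (eta a)| <= f n.

Definition controlled (phi : K -> R) : Prop := exists f, controlled_by phi f.

Definition linearly_controlled (phi : K -> R) (C0 : R) : Prop :=
  controlled_by phi (fun n => C0 * n%:R + C0).

Definition extends (Phi : G -> R) (phi : K -> R) : Prop :=
  forall k : K, Phi (val k) = phi k.

End Relative.

(* Main.v *)
(* Extend phi to words w in the letters of K * F(X) through eta, and let F g be
   a near-minimum of C |w| + phi w over the words w for g, with C large compared
   to delta, C0 and D(phi).  Linear control bounds this cost from below.  A
   non-geodesic short subword of a near-minimizer could be shortened at a profit,
   so near-minimizers are local geodesics, and by hyperbolicity every geodesic
   from 1 to g stays close to them.  Hence F is almost additive along geodesics.
   Inserting a short detour s changes costs by at most F s + F (s^-1), where the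
   values of phi, which may be large, cancel by antisymmetry.  Cutting a geodesic
   triangle at the center of a tripod then shows that (F g - F (g^-1)) / 2 is a
   quasimorphism; it is close to phi on K, where it can be replaced by phi.
   Finally, a closed word that is not short is not a local geodesic either, so
   that Dehn's algorithm turns arbitrary control into linear control. *)
From HB Require Import structures.
Require Import Defs.
From mathcomp Require Import all_boot all_order all_algebra.
From mathcomp Require Import zify ring lra.
From mathcomp Require Import boolp classical_sets reals.
Set Implicit Arguments.
Unset Strict Implicit.
Unset Printing Implicit Defensive.
Import Order.TTheory GRing.Theory Num.Theory.
Local Open Scope classical_set_scope.
Local Open Scope ring_scope.

(** * Local geodesics in slim discrete spaces *)

Section DiscreteGeodesics.
Local Open Scope nat_scope.
Variables (T : Type) (d : T -> T -> nat).

Definition discrete_geodesic (n : nat) (c : nat -> T) : Prop :=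
  forall i j, i <= j <= n -> d (c i) (c j) = j - i.

Definition between (x y u : T) : Prop := d x u + d u y = d x y.

(* The side c is a prescribed geodesic, while for the two other sides any
   geodesic is allowed. *)
Definition discretely_slim (D : nat) : Prop :=
  forall n c z u, discrete_geodesic n c -> between (c n) z u ->
    (exists2 w, between z (c 0) w & d u w <= D) \/
    (exists2 i, i <= n & d u (c i) <= D).

Hypothesis dxx : forall x, d x x = 0.
Hypothesis dC : forall x y, d x y = d y x.
Hypothesis dT : forall y x z, d x z <= d x y + d y z.
Hypothesis d_geodesic : forall x y, exists c,
  [/\ discrete_geodesic (d x y) c, c 0 = x & c (d x y) = y].

Variable D : nat.
Hypothesis slim : discretely_slim D.

Lemma betweenC x y u : between x y u -> between y x u.
Proof. by rewrite /between addnC (dC u) (dC x u) (dC x y). Qed.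

Lemma discrete_geodesic_between n c i : discrete_geodesic n c -> i <= n ->
  between (c 0) (c n) (c i).
Proof. by move=> gc lein; rewrite /between !gc; lia. Qed.

Lemma discrete_geodesic_dist n c i j : discrete_geodesic n c ->
  i <= n -> j <= n -> d (c i) (c j) = (i - j) + (j - i).
Proof.
move=> gc lein lejn; case: (leqP i j) => ij; first by rewrite gc; lia.
by rewrite dC gc; lia.
Qed.

(** The segment may run backwards along [c]: the points of [c] nearest to two successive points of
    another path can come in either order. *)
Lemma discrete_geodesic_segment n c i j : discrete_geodesic n c ->
  i <= n -> j <= n ->
  exists m c', [/\ discrete_geodesic m c', c' 0 = c i, c' m = c j &
    forall k, k <= m -> exists2 l, l <= n & c' k = c l].
Proof.
move=> gc lein lejn; case: (leqP i j) => ij.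
  exists (j - i), (fun k => c (i + k)); split=> [k l kl||| k km] /=.
  - by rewrite gc; lia.
  - by rewrite addn0.
  - by congr c; lia.
  - by exists (i + k) => //; lia.
exists (i - j), (fun k => c (i - k)); split=> [k l kl||| k km] /=.
- by rewrite dC gc; lia.
- by rewrite subn0.
- by congr c; lia.
- by exists (i - k) => //; lia.
Qed.

(** Geodesics from [x] to [u] and from [u] to [y] are glued at [u]. A shortcut between the two
    halves would, by the triangle inequality, bring [x] and [y] closer than [d x y]. *)
Lemma geodesic_through x y u : between x y u -> exists c,
  [/\ discrete_geodesic (d x y) c, c 0 = x, c (d x y) = y & c (d x u) = u].
Proof.
move=> bu; have [a [ga a0 an]] := d_geodesic x u.
have [b [gb b0 bn]] := d_geodesic u y; set k := d x u in ga an *.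
pose c i := if i <= k then a i else b (i - k).
have cn : c (d x y) = y.
  move: bu; rewrite /between /c -/k => bu; case: leqP => [le|lt].
    have uy : d u y = 0 by lia.
    have -> : d x y = k by lia.
    by rewrite an -bn uy b0.
  by have -> : d x y - k = d u y by lia.
exists c; split=> //; last by rewrite /c leqnn.
  move=> i j /andP[ij jn]; have := bu; rewrite /between -/k => bu'.
  rewrite /c; case: (leqP i k) => ik; case: (leqP j k) => jk; try lia.
  - by rewrite ga //; lia.
  - have ai : d (a 0) (a i) = i by rewrite ga; lia.
    have ia : d (a i) (a k) = k - i by rewrite ga; lia.
    have bj : d (b 0) (b (j - k)) = j - k by rewrite gb; lia.
    have jb : d (b (j - k)) (b (d u y)) = d u y - (j - k) by rewrite gb; lia.
    rewrite a0 in ai; rewrite an in ia; rewrite b0 in bj; rewrite bn in jb.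
    have := dT u (a i) (b (j - k)); have := dT (a i) x y.
    by have := dT (b (j - k)) (a i) y; lia.
  - by rewrite gb; lia.
Qed.

Lemma slim_triangle x y z u : between x y u ->
  exists2 w, between y z w \/ between z x w & d u w <= D.
Proof.
move=> bu; have [c [gc c0 cn]] := d_geodesic z x.
have := slim (u := u) gc; rewrite cn c0 => /(_ y bu) [[w bw dw]|[i lei dw]].
  by exists w => //; left.
exists (c i) => //; right.
by have := discrete_geodesic_between gc lei; rewrite c0 cn.
Qed.

Definition local_geodesic (L m : nat) (p : nat -> T) : Prop :=
  forall i j, i <= j <= m -> j - i <= L -> d (p i) (p j) = j - i.

Lemma nearest_point n (c : nat -> T) x :
  exists2 j, j <= n & forall k, k <= n -> d x (c j) <= d x (c k).
Proof.
have [j _ jP] := @arg_minnP 'I_n.+1 ord0 xpredT (fun j => d x (c j)) isT.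
exists j; first by rewrite -ltnS.
by move=> k kn; exact: (jP (Ordinal (kn : k < n.+1))).
Qed.

(* Look at a point of p that is furthest from c, and at the slim quadrilateral
   spanned by the points of p a bit before and after it and by their nearest
   points on c: the furthest point cannot be close to one of the two sides that
   join p to c, unless this side starts at an end of p. *)
Lemma local_geodesic_near L m p n c : 8 * D + 2 <= L ->
  local_geodesic L m p -> discrete_geodesic n c -> p 0 = c 0 -> p m = c n ->
  forall i, i <= m -> exists2 j, j <= n & d (p i) (c j) <= 2 * D.
Proof.
move=> leL lp gc p0 pm.
have /choice[f fP] : forall x, exists j, j <= n /\
    forall k, k <= n -> d x (c j) <= d x (c k).
  by move=> x; have [j jn jP] := nearest_point n c x; exists j.
pose far x := d x (c (f x)).
have farP x k : k <= n -> far x <= d x (c k) by case: (fP x) => _; apply.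
suff: forall i, i <= m -> far (p i) <= 2 * D.
  by move=> H i im; exists (f (p i)); [case: (fP (p i))|exact: H].
have [i0 _ iP] :=
  @arg_maxnP 'I_m.+1 ord0 xpredT (fun j => far (p j)) isT.
have {iP} iP k : k <= m -> far (p k) <= far (p i0).
  by move=> km; exact: (iP (Ordinal (km : k < m.+1))).
have im : i0 <= m by rewrite -ltnS.
move: (nat_of_ord i0) iP im => {i0} i iP im.
move=> k km; apply: leq_trans (iP _ km) _ => {k km}.
(* The stretch around [i] reaches [4 * D + 1] steps to both sides, or to an end of [p] (subtraction
   truncates at 0). Its length is at most [8 * D + 2], so it is geodesic. *)
set a := i - (4 * D).+1; set b := minn (i + (4 * D).+1) m.
(* The assumptions leave only the case that [e] is an end of [p]. There [far] vanishes, so [w] is at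
   distance 0 from [c]. *)
have side e w : e <= m -> d (p i) (p e) = (i - e) + (e - i) ->
    (i - e) + (e - i) <= 4 * D -> e = 0 \/ e = m \/ (i - e) + (e - i) = (4 * D).+1 ->
    d (p i) w <= 2 * D -> between (p e) (c (f (p e))) w -> far (p i) <= 2 * D.
  move=> em die le4 ee diw bw.
  have far0 : far (p e) = 0 -> far (p i) <= 2 * D.
    move=> fe; have [fn _] := fP (p e).
    have := farP (p i) _ fn; have := dT w (p i) (c (f (p e))).
    by move: bw fe; rewrite /between /far; lia.
  case: ee => [e0|[e_m|]]; last by lia.
    by apply: far0; apply/eqP; rewrite -leqn0 -(dxx (c 0)) -{1}p0 -e0 e0 farP.
  by apply: far0; apply/eqP; rewrite -leqn0 -(dxx (c n)) -{1}pm -e_m e_m farP.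
(* Beyond [w], [p i] and [p e] can take the same way to [c (f (p e))]. As [far] is maximal at [i],
   [w] is no further from [p e] than from [p i], and the two distances add up to at most [4 * D]. *)
have le4 e w : e <= m -> d (p i) (p e) = (i - e) + (e - i) ->
    d (p i) w <= 2 * D -> between (p e) (c (f (p e))) w ->
    far (p i) <= 2 * D \/ (i - e) + (e - i) <= 4 * D.
  move=> em die diw bw; case: (leqP (far (p i)) (2 * D)) => lt; [by left|right].
  have := iP _ em; have [fn _] := fP (p e); have := farP (p i) _ fn.
  have := dT w (p i) (c (f (p e))); have := dT w (p i) (p e).
  by move: bw; rewrite /between -die /far (dC w (p e)); lia.
have am : a <= m by rewrite /a; lia.
have bm : b <= m by rewrite /b; lia.
have da : d (p i) (p a) = (i - a) + (a - i) by rewrite dC lp /a; lia.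
have db : d (p i) (p b) = (i - b) + (b - i) by rewrite lp /b; lia.
have sa w : d (p i) w <= 2 * D -> between (p a) (c (f (p a))) w ->
    far (p i) <= 2 * D.
  move=> diw bw; case: (le4 a w) => // lea.
  by apply: (side a w) => //; rewrite /a in lea *; lia.
have sb w : d (p i) w <= 2 * D -> between (p b) (c (f (p b))) w ->
    far (p i) <= 2 * D.
  move=> diw bw; case: (le4 b w) => // leb.
  by apply: (side b w) => //; rewrite /b in leb *; lia.
have bi : between (p a) (p b) (p i).
  by rewrite /between !lp /a /b; lia.
(* The diagonal from [c (f (p b))] to [p a] cuts the quadrilateral into two triangles, each of which
   loses [D]. *)
have [w [bw|bw] dw] := slim_triangle (c (f (p b))) bi.
  by apply: (sb w) => //; lia.
have [fan _] := fP (p a); have [fbn _] := fP (p b).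
have [k [c' [gc' c'0 c'k c'P]]] := discrete_geodesic_segment gc fan fbn.
have := slim (z := p a) (u := w) gc'; rewrite c'k c'0 => /(_ bw).
case=> [[v bv dv]|[j /c'P[l ln ->] dv]]; have := dT w (p i).
  by move=> /(_ v) H; apply: (sa v) => //; lia.
by move=> /(_ (c l)) H; apply: leq_trans (farP _ _ ln) _; lia.
Qed.

(** A discrete intermediate value principle, used to find the place where a path leaves a
    neighbourhood. *)
Lemma transition_index (P : nat -> Prop) m : P 0 ->
  exists2 i, i <= m & P i /\ (i = m \/ i < m /\ ~ P i.+1).
Proof.
move=> P0; elim: m => [|m [i im [Pi [ei|[lt nP]]]]];
  first by exists 0 => //; split; [|left].
- case: (pselect (P m.+1)) => PS; first by exists m.+1 => //; split; [|left].
  by exists i; [lia|split=> //; right; rewrite ei; split; [lia|]].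
- by exists i; [lia|split=> //; right; split; [lia|]].
Qed.

(** By [local_geodesic_near], [p] follows [c] up to [2 * D]. At some step [p] passes from points
    near the part of [c] up to [k] to points near the part after [k]; the two parameters on [c]
    differ by at most [2 * D + 1 + 2 * D], and [k] lies between them. If there is no such step, the
    end of [p] does the job. *)
Lemma geodesic_near_local L m p n c : 8 * D + 2 <= L ->
  local_geodesic L m p -> discrete_geodesic n c -> p 0 = c 0 -> p m = c n ->
  forall k, k <= n -> exists2 i, i <= m & d (c k) (p i) <= 6 * D + 1.
Proof.
move=> leL lp gc p0 pm k kn.
pose P i := exists2 j, j <= k & d (p i) (c j) <= 2 * D.
have [|i im [[j jk dj] H]] := @transition_index P m.
  by exists 0 => //; rewrite p0 dxx.
exists i => //; have jn : j <= n by lia.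
have := dT (c j) (c k) (p i); rewrite (discrete_geodesic_dist gc) // (dC (c j)).
suff: k - j <= 4 * D + 1 by lia.
case: H => [im'|[lt nP]].
  by move: dj; rewrite im' pm (discrete_geodesic_dist gc) //; lia.
have [j' j'n dj'] := local_geodesic_near leL lp gc p0 pm lt.
have kj' : k < j' by rewrite ltnNge; apply/negP => j'k; apply: nP; exists j'.
have d1 : d (p i) (p i.+1) = 1 by rewrite lp; lia.
have := dT (p i) (c j) (c j'); have := dT (p i.+1) (p i) (c j').
by rewrite (discrete_geodesic_dist gc) // (dC (c j)); lia.
Qed.

(** On a geodesic from [x] to [y], take a point [D]-close to the side from [x] to [z] whose
    successor is not. By slimness the successor is [D]-close to the side from [y] to [z], whence
    [D + 1]. *)
Lemma slim_tripod x y z : exists u v w,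
  [/\ between x y u, between y z v, between x z w,
      d u v <= D + 1 & d u w <= D].
Proof.
have [c [gc c0 cn]] := d_geodesic x y; set n := d x y in gc cn.
pose P i := exists2 w, between x z w & d (c i) w <= D.
have [|i im [[w bw dw] H]] := @transition_index P n.
  by exists (c 0); rewrite ?dxx // c0 /between dxx.
have bi k : k <= n -> between x y (c k).
  by move=> kn; rewrite -c0 -cn; exact: discrete_geodesic_between.
case: H => [im'|[lt nP]].
  exists (c i), y, w; split=> //; first exact: bi.
    by rewrite /between dxx.
  by rewrite im' cn dxx.
have [v [bv|bv] dv] := slim_triangle z (bi _ lt); last first.
  by case: nP; exists v => //; exact: betweenC.
exists (c i), v, w; split=> //; first exact: bi.
have d1 : d (c i) (c i.+1) = 1 by rewrite gc; lia.
by have := dT (c i.+1) (c i) v; lia.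
Qed.

End DiscreteGeodesics.

(** * Words in the alphabet of K * F(X) *)

Section Words.
Local Open Scope group_scope.
Variables (G : groupType) (S : pred G) (K : subGroupType S) (X : set G).
Implicit Types (w u v : seq (letter K X)) (g h : G).

Definition word_val w : G := \prod_(l <- w) eval_letter (val : K -> G) (val : X -> G) l.

Definition word_eta w : K := \prod_(l <- w) eval_letter id (fun _ : X => 1) l.

Lemma word_val_cat u v : word_val (u ++ v) = word_val u * word_val v.
Proof. exact: big_cat. Qed.

Lemma word_eta_cat u v : word_eta (u ++ v) = word_eta u * word_eta v.
Proof. exact: big_cat. Qed.

Lemma word_val_nil : word_val [::] = 1.
Proof. exact: big_nil. Qed.

Lemma eval_invw (H : groupType) (f : K -> H) (h : X -> H) w :
  (forall k, f k^-1 = (f k)^-1) ->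
  \prod_(l <- invw w) eval_letter f h l = (\prod_(l <- w) eval_letter f h l)^-1.
Proof.
move=> fV; rewrite /invw; elim: w => [|l w IHw]; first by rewrite !big_nil invg1.
rewrite /= rev_cons -cats1 big_cat big_seq1 big_cons /= IHw invgM; congr (_ * _).
by case: l => [k|[x []]] //=; rewrite invgK.
Qed.

Lemma word_val_inv w : word_val (invw w) = (word_val w)^-1.
Proof. by apply: eval_invw => k; exact: gmulfV. Qed.

Lemma word_eta_inv w : word_eta (invw w) = (word_eta w)^-1.
Proof. exact: eval_invw. Qed.

Lemma size_invw w : size (invw w) = size w.
Proof. by rewrite size_rev size_map. Qed.

(** Control is only assumed on normal forms. Reduction changes neither image and does not lengthen
    the word, so that control applies to arbitrary words. *)
Lemma normal_form_of_word w : exists a : freeprod K X,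
  [/\ theta a = word_val w, eta a = word_eta w & (fp_length a <= size w)%N].
Proof.
elim: w => [|l w [a [ta ea la]]].
  by exists (fp_one K X); rewrite /theta /eta /fp_lift /word_val /word_eta !big_nil.
(* The normal form of the single letter [l]: it is empty if [l] is the trivial element of [K]. *)
pose b : freeprod K X := FreeProd (normal_push l (isT : normal [::])).
have size_push l' (v : seq (letter K X)) : (size (push l' v) <= (size v).+1)%N.
  case: l' v => [k|[x e]] [|[k'|[y e']] v] //=; case: ifP => //= _.
  - exact: leqW.
  - by rewrite leqW.
have vb (H : groupType) (f : K -> H) (h : X -> H) :
    {morph f : x y / x * y} -> fp_lift f h b = eval_letter f h l.
  move=> fM; have f1 : f 1 = 1 by apply: (mulgI (f 1)); rewrite -fM !mulg1.
  rewrite /fp_lift /b /=; case: l {b} => [k|[x e]] /=; last by rewrite big_seq1.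
  by case: eqP => [->|_]; rewrite ?big_nil ?big_seq1 //= f1.
exists (fp_mul b a); split.
- have vM : {morph (val : K -> G) : x y / x * y} by move=> x y; exact: gmulfM.
  rewrite /theta (fp_lift_morphism _ vM) vb // /word_val big_cons; congr (_ * _).
  exact: ta.
- rewrite /eta (fp_lift_morphism (f := @id K) (fun _ : X => 1) (fun _ _ => erefl)).
  by rewrite vb // /word_eta big_cons; congr (_ * _); exact: ea.
- rewrite /fp_length /= mulw_push ?(nformP a) //.
  by apply: leq_trans (size_push _ _) _.
Qed.

(** Made into a subgroup below, since relative generation is stated through the subgroups that
    contain [K] and [X]. *)
Definition in_word_range : {pred G} := [pred g | `[< exists w, word_val w = g >]].

Lemma in_word_rangeM : mulg_closed in_word_range.
Proof.
move=> g h; rewrite !inE => -[u <-] [v <-].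
by exists (u ++ v); rewrite word_val_cat.
Qed.

Lemma in_word_range1 : 1 \in in_word_range.
Proof. by rewrite inE; exists [::]; rewrite word_val_nil. Qed.

Lemma in_word_rangeV : invg_closed in_word_range.
Proof.
move=> g; rewrite !inE => -[u <-].
by exists (invw u); rewrite word_val_inv.
Qed.

HB.instance Definition _ := isMulClosed.Build G in_word_range in_word_rangeM.
HB.instance Definition _ := isMul1Closed.Build G in_word_range in_word_range1.
HB.instance Definition _ := isInvClosed.Build G in_word_range in_word_rangeV.

Lemma word_val_surj g : relative_generating_set K X -> exists w, word_val w = g.
Proof.
move=> gen; have : g \in in_word_range.
  apply: (gen (GroupClosed.clone G in_word_range _)) => [k|x Xx]; rewrite inE.
    by exists [:: inl k]; rewrite /word_val big_seq1.
  by exists [:: inr (exist _ x (mem_set Xx), false)]; rewrite /word_val big_seq1.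
by rewrite inE.
Qed.

Lemma shortest_words_exist : relative_generating_set K X ->
  exists sw : G -> seq (letter K X), (forall g, word_val (sw g) = g) /\
    forall w, (size (sw (word_val w)) <= size w)%N.
Proof.
move=> gen.
suff /choice[sw swP] : forall g, exists w, word_val w = g /\
    forall w', word_val w' = g -> (size w <= size w')%N.
  exists sw; split=> [g|w]; first by case: (swP g).
  by case: (swP (word_val w)) => _; apply.
move=> g; have [w wg] := word_val_surj g gen.
have ex : exists n, `[< exists2 w, word_val w = g & size w = n >].
  by exists (size w); apply/asboolP; exists w.
case: (ex_minnP ex) => n /asboolP[v vg sv] nP; exists v; split=> // w' w'g.
by rewrite sv; apply: nP; apply/asboolP; exists w'.
Qed.

(** * The word metric and paths labelled by words *)

Variable sw : G -> seq (letter K X).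
Hypothesis word_val_sw : forall g, word_val (sw g) = g.
Hypothesis size_sw_min : forall w, (size (sw (word_val w)) <= size w)%N.

Definition word_dist g h : nat := size (sw (g^-1 * h)).

Lemma word_distMl x g h : word_dist (x * g) (x * h) = word_dist g h.
Proof. by rewrite /word_dist invgM -!mulgA mulKg. Qed.

Lemma word_distVl x g h : word_dist (x^-1 * g) h = word_dist g (x * h).
Proof. by rewrite -(word_distMl x) mulVKg. Qed.

Lemma word_distVr x g h : word_dist g (x^-1 * h) = word_dist (x * g) h.
Proof. by rewrite -(word_distMl x) mulVKg. Qed.

Lemma word_dist_step g w : (word_dist g (g * word_val w) <= size w)%N.
Proof. by rewrite /word_dist mulKg. Qed.

Lemma word_distxx g : word_dist g g = 0%N.
Proof. by apply/eqP; rewrite -leqn0 -{2}(mulg1 g) -word_val_nil word_dist_step. Qed.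

Lemma word_distC g h : word_dist g h = word_dist h g.
Proof.
suff H x y : (word_dist x y <= word_dist y x)%N by apply/eqP; rewrite eqn_leq !H.
rewrite {2}/word_dist -size_invw; apply: leq_trans (size_sw_min _).
by rewrite word_val_inv word_val_sw invgM invgK.
Qed.

Lemma word_dist_triangle h g k :
  (word_dist g k <= word_dist g h + word_dist h k)%N.
Proof.
rewrite /(word_dist g h) /(word_dist h k) -size_cat.
apply: leq_trans (size_sw_min _); rewrite word_val_cat !word_val_sw.
by rewrite /word_dist mulgA mulgK.
Qed.

Definition word_path g w (i : nat) : G := g * word_val (take i w).

Lemma word_path0 g w : word_path g w 0 = g.
Proof. by rewrite /word_path take0 word_val_nil mulg1. Qed.

Lemma word_path_size g w : word_path g w (size w) = g * word_val w.
Proof. by rewrite /word_path take_size. Qed.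

Lemma word_path_drop g w i j : (i <= j)%N ->
  word_path g w j = word_path g w i * word_val (drop i (take j w)).
Proof.
move=> ij; rewrite /word_path -mulgA -word_val_cat.
by rewrite -{1}(cat_take_drop i (take j w)) take_takel.
Qed.

Definition geodesic_word w : Prop := word_dist 1 (word_val w) = size w.

Lemma geodesic_word_sw g : geodesic_word (sw g).
Proof. by rewrite /geodesic_word word_val_sw /word_dist invg1 mul1g. Qed.

Lemma geodesic_word_infix u v w : geodesic_word (u ++ v ++ w) -> geodesic_word v.
Proof.
rewrite /geodesic_word !size_cat /word_dist invg1 !mul1g => e.
apply/eqP; rewrite eqn_leq size_sw_min /=.
rewrite -(leq_add2l (size u)) -(leq_add2r (size w)) -!addnA -e.
have := size_sw_min (u ++ sw (word_val v) ++ w).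
by rewrite !word_val_cat word_val_sw !size_cat.
Qed.

Lemma word_path_local_geodesic L g w :
  (forall u v t, w = u ++ v ++ t -> (size v <= L)%N -> geodesic_word v) ->
  local_geodesic word_dist L (size w) (word_path g w).
Proof.
move=> lw i j /andP[ij jm] ijL.
rewrite (word_path_drop _ _ ij) -[X in word_dist X _]mulg1 word_distMl.
have sz : size (drop i (take j w)) = (j - i)%N by rewrite size_drop size_takel.
rewrite (lw (take i w) _ (drop j w)) ?sz //.
by rewrite catA -{1}(cat_take_drop j w) -{1}(cat_take_drop i (take j w)) take_takel.
Qed.

Lemma word_path_geodesic g w : geodesic_word w ->
  discrete_geodesic word_dist (size w) (word_path g w).
Proof.
move=> gw i j ij; apply: (@word_path_local_geodesic (size w)) => //; last by lia.
by move=> u v t e _; apply: (@geodesic_word_infix u _ t); rewrite -e.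
Qed.

Lemma word_dist_geodesic g h : exists c,
  [/\ discrete_geodesic word_dist (word_dist g h) c, c 0%N = g
    & c (word_dist g h) = h].
Proof.
exists (word_path g (sw (g^-1 * h))); split; first 1 last.
- exact: word_path0.
- by rewrite word_path_size word_val_sw mulVKg.
- exact/word_path_geodesic/geodesic_word_sw.
Qed.

End Words.

(** * From the Cayley graph to its vertices *)

Section CayleyGraph.
Variables (R : realType) (G : groupType) (S : pred G) (K : subGroupType S).
Variable X : set G.
Local Notation word_val := (@word_val G S K X).
Local Notation word_dist := (@word_dist G S K X).
Hypothesis symX : symmetric_set X.
Variable sw : G -> seq (letter K X).
Hypothesis word_val_sw : forall g, word_val (sw g) = g.
Hypothesis size_sw_min : forall w, (size (sw (word_val w)) <= size w)%N.

Notation vdist := (vertex_dist R K X).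
Notation point := (cayley_point R K X).
Implicit Types (g h : G) (p q : point).

Lemma letter_of_alphabet (a : alphabet K X) : exists l : letter K X,
  eval_letter (val : K -> G) (val : X -> G) l = alphabet_val a.
Proof. by case: a => [k|x]; [exists (inl k)|exists (inr (x, false))]. Qed.

(** Symmetry of [X] turns the formal inverse of [x] into an element of [X]. *)
Lemma alphabet_of_letter (l : letter K X) : exists a : alphabet K X,
  alphabet_val a = eval_letter (val : K -> G) (val : X -> G) l.
Proof.
case: l => [k|[x [|]]]; [by exists (inl k)| |by exists (inr x)].
by exists (inr (exist (fun y => y \in X) _ (mem_set (symX (set_mem (valP x)))))).
Qed.

Lemma alphabet_word_exists g h : exists2 w : seq (alphabet K X),
  (g * \prod_(a <- w) alphabet_val a = h)%g & size w = word_dist sw g h.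
Proof.
have [f fP] := choice alphabet_of_letter.
exists (map f (sw (g^-1 * h)%g)); last by rewrite size_map.
rewrite big_map (eq_bigr _ (fun l _ => fP l)) -[X in (g * X)%g]/(word_val _).
by rewrite word_val_sw mulVKg.
Qed.

Lemma word_dist_alphabet_word g (w : seq (alphabet K X)) :
  (word_dist sw g (g * \prod_(a <- w) alphabet_val a)%g <= size w)%N.
Proof.
have [f fP] := choice letter_of_alphabet.
have -> : (\prod_(a <- w) alphabet_val a)%g = word_val (map f w).
  by rewrite /word_val big_map (eq_bigr _ (fun a _ => fP a)).
by rewrite -(size_map f w) word_dist_step.
Qed.

Lemma vertex_distE g h : vdist g h = (word_dist sw g h)%:R.
Proof.
have [w wP wn] := alphabet_word_exists g h.
apply/eqP; rewrite eq_le; apply/andP; split.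
  by apply: ge_inf; [exists 0 => _ [v _ <-]|exists w; rewrite ?wn].
apply: lb_le_inf; first by exists (size w)%:R, w.
by move=> _ [v <- <-]; rewrite ler_nat word_dist_alphabet_word.
Qed.

Lemma word_dist_label g (a : alphabet K X) :
  (word_dist sw g (g * alphabet_val a)%g <= 1)%N.
Proof. by have := word_dist_alphabet_word g [:: a]; rewrite big_seq1. Qed.

Lemma word_dist1_label g h : word_dist sw g h = 1%N ->
  exists a : alphabet K X, (g * alphabet_val a)%g = h /\ alphabet_val a <> 1%g.
Proof.
move=> d1; have [w wh] := alphabet_word_exists g h.
rewrite d1; case: w wh => [|a [|]] //=; rewrite big_seq1 => ah _.
exists a; split=> // a1; move: d1.
by rewrite -ah a1 mulg1 word_distxx.
Qed.

Lemma cp_off_ge0 p e : 0 <= cp_off p e.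
Proof. by rewrite /cp_off; have := cp_pos_bounds p; case: e; lra. Qed.

Lemma cayley_dist_lb p q m :
  (forall e e', m <= cp_off p e + vdist (cp_end p e) (cp_end q e') + cp_off q e') ->
  (cp_base q = cp_base p -> cp_label q = cp_label p ->
     m <= `|cp_pos p - cp_pos q|) ->
  (cp_base q = cp_tip p -> opposite (cp_label p) (cp_label q) ->
     m <= `|cp_pos p - (1 - cp_pos q)|) ->
  m <= cayley_dist p q.
Proof.
move=> m1 m2 m3; apply: lb_le_inf.
  by exists (cp_off p true + vdist (cp_end p true) (cp_end q true) + cp_off q true);
     left; left; exists (true, true).
move=> _ [[[[e e'] _ <-]|[? ? ->]]|[? ? ->]]; [exact: m1|exact: m2|exact: m3].
Qed.

Lemma cayley_dist_lbound p q : has_lbound (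
  [set cp_off p i.1 + vdist (cp_end p i.1) (cp_end q i.2)
            + cp_off q i.2 | i in [set: bool * bool]]
   `|` [set r : R | [/\ cp_base q = cp_base p, cp_label q = cp_label p
                  & r = `|cp_pos p - cp_pos q|]]
   `|` [set r : R | [/\ cp_base q = cp_tip p, opposite (cp_label p) (cp_label q)
                  & r = `|cp_pos p - (1 - cp_pos q)|]]).
Proof.
exists 0 => _ [[[[e e'] _ <-]|[? ? ->]]|[? ? ->]] //.
by rewrite vertex_distE !addr_ge0 ?cp_off_ge0.
Qed.

Lemma cayley_dist_le_ends p q e e' :
  cayley_dist p q <= cp_off p e + vdist (cp_end p e) (cp_end q e') + cp_off q e'.
Proof.
by apply: ge_inf; [exact: cayley_dist_lbound|left; left; exists (e, e')].
Qed.

Lemma cayley_dist_le_edge p q : cp_base q = cp_base p ->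
  cp_label q = cp_label p -> cayley_dist p q <= `|cp_pos p - cp_pos q|.
Proof.
by move=> ? ?; apply: ge_inf; [exact: cayley_dist_lbound|left; right].
Qed.

Lemma cayley_dist_ge0 p q : 0 <= cayley_dist p q.
Proof.
by apply: cayley_dist_lb => // e e'; rewrite vertex_distE !addr_ge0 ?cp_off_ge0.
Qed.

Lemma word_dist_end p e : (word_dist sw (cp_base p) (cp_end p e) <= 1)%N.
Proof. by case: e; rewrite /cp_end ?word_distxx // word_dist_label. Qed.

(** Whichever ends a route from [p] to [q] uses, each is within 1 of the base of its edge, whence
    the 2. *)
Lemma word_dist_base_le p q :
  (word_dist sw (cp_base p) (cp_base q))%:R <= cayley_dist p q + 2.
Proof.
rewrite -lerBlDr; apply: cayley_dist_lb => [e e'||].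
- rewrite vertex_distE; have := cp_off_ge0 p e; have := cp_off_ge0 q e'.
  suff : (word_dist sw (cp_base p) (cp_base q))%:R <=
      (1 + word_dist sw (cp_end p e) (cp_end q e') + 1)%:R :> R.
    by rewrite !natrD; lra.
  rewrite ler_nat.
  have := word_dist_triangle word_val_sw size_sw_min (cp_end p e) (cp_base p) (cp_base q).
  have := word_dist_triangle word_val_sw size_sw_min (cp_end q e') (cp_end p e)
    (cp_base q).
  have := word_dist_end p e; have := word_dist_end q e'.
  by rewrite (word_distC word_val_sw size_sw_min (cp_base q)); lia.
- move=> -> _; rewrite word_distxx //.
  by have := normr_ge0 (cp_pos p - cp_pos q); lra.
- move=> -> _; have := word_dist_end p true; rewrite -(ler_nat R) /=.
  by have := normr_ge0 (cp_pos p - (1 - cp_pos q)); lra.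
Qed.

Lemma opposite_val (a b : alphabet K X) : opposite a b ->
  alphabet_val b = (alphabet_val a)^-1%g.
Proof. by case: a b => [k|x] [k'|y] //= ->; exact: gmulfV. Qed.

(** * Vertex geodesics as geodesics of the Cayley graph *)

Section RealGeodesic.
Variables (n : nat) (c : nat -> G) (lab : nat -> alphabet K X).
Hypothesis gc : discrete_geodesic (word_dist sw) n c.
Hypothesis lab1 : forall i, alphabet_val (lab i) <> 1%g.
Hypothesis labP : forall i, (i < n)%N -> (c i * alphabet_val (lab i))%g = c i.+1.

(* Capping the index at n.-1 puts the parameter n at the tip of the last edge,
   so that both ends of the edge of any point lie on c. *)
Let idx (t : R) : nat := minn (Num.truncn t) n.-1.

(** Clamping gives a legal position for every real [t]; on the interval from 0 to [n] it has no
    effect. *)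
Let pos (t : R) : R := Num.min 1 (Num.max 0 (t - (idx t)%:R)).

Let pos_bounds t : 0 <= pos t <= 1.
Proof. by rewrite /pos le_min ler01 le_max lexx ge_min lexx. Qed.

Definition real_path (t : R) : point :=
  CayleyPoint (c (idx t)) (@lab1 (idx t)) (pos_bounds t).

Lemma real_path_base t : exists2 i, (i <= n)%N & cp_base (real_path t) = c i.
Proof. by exists (idx t) => //=; rewrite /idx; lia. Qed.

Let natrN0 (t : R) : (0 < n)%N -> 0 <= t <= n%:R ->
  [/\ (idx t < n)%N, (idx t)%:R <= t & t <= (idx t).+1%:R].
Proof.
move=> n0 /andP[t0 tn]; have /andP[le lt] := truncn_itv t0.
rewrite /idx; case: (leqP (Num.truncn t) n.-1) => H; split => //; try lia.
- exact: ltW.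
- by apply: le_trans le; rewrite ler_nat; lia.
- by rewrite prednK.
Qed.

Let vdist_c i j : (i <= n)%N -> (j <= n)%N ->
  vdist (c i) (c j) = `|i%:R - j%:R|.
Proof.
move=> lein lejn; rewrite vertex_distE.
rewrite (discrete_geodesic_dist (word_distC word_val_sw size_sw_min) gc) //.
case: (leqP i j) => ij.
  by rewrite distrC (_ : i - j = 0)%N ?add0n ?natrB ?ger0_norm ?subr_ge0 ?ler_nat //; lia.
rewrite (_ : j - i = 0)%N ?addn0 ?natrB ?ger0_norm ?subr_ge0 ?ler_nat //; lia.
Qed.

Let c_inj i j : (i <= n)%N -> (j <= n)%N -> c i = c j -> i = j.
Proof.
move=> lein lejn e; have := vdist_c lein lejn.
rewrite e vdist_c // subrr normr0 => /esym/eqP.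
by rewrite normr_eq0 subr_eq0 eqr_nat => /eqP.
Qed.

Let real_path_posE t : (0 < n)%N -> 0 <= t <= n%:R ->
  cp_pos (real_path t) = t - (idx t)%:R.
Proof.
move=> n0 tn; have [_ t1 t2] := natrN0 n0 tn; move: t2; rewrite -natr1 /= /pos => t2.
by rewrite max_r ?min_r //; lra.
Qed.

Let real_path_end t e : (0 < n)%N -> 0 <= t <= n%:R ->
  cp_end (real_path t) e = c (idx t + e)%N /\
  cp_off (real_path t) e = `|t - (idx t + e)%N%:R|.
Proof.
move=> n0 tn; have [tin t1 t2] := natrN0 n0 tn; have tE := real_path_posE n0 tn.
case: e; rewrite /cp_end /cp_off.
  rewrite tE addn1 /cp_tip /= labP //; split=> //.
  by rewrite distrC ger0_norm ?subr_ge0 // -natr1; lra.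
by rewrite tE addn0; split=> //; rewrite ger0_norm ?subr_ge0.
Qed.

Lemma real_path_dist s t : 0 <= s <= n%:R -> 0 <= t <= n%:R ->
  cayley_dist (real_path s) (real_path t) = `|s - t|.
Proof.
case: (posnP n) => [n0|n0] sn tn.
  have -> : s = t by move: sn tn; rewrite n0; lra.
  apply/eqP; rewrite eq_le subrr normr0 cayley_dist_ge0 andbT.
  by apply: le_trans (cayley_dist_le_edge _ _) _; rewrite // subrr normr0.
have [sin s1 s2] := natrN0 n0 sn; have [tin t1 t2] := natrN0 n0 tn.
have sE : pos s = s - _ := real_path_posE n0 sn.
have tE : pos t = t - _ := real_path_posE n0 tn.
(* All ends of the two edges lie on [c], so a route through ends has the length of a path on the
   real line through two integers. *)
have endE e e' : cp_off (real_path s) e +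
    vdist (cp_end (real_path s) e) (cp_end (real_path t) e') +
    cp_off (real_path t) e' =
    `|s - (idx s + e)%N%:R| + `|(idx s + e)%N%:R - (idx t + e')%N%:R| +
    `|t - (idx t + e')%N%:R|.
  have [-> ->] := real_path_end e n0 sn; have [-> ->] := real_path_end e' n0 tn.
  by rewrite vdist_c //; case: e; case: e'; lia.
apply/eqP; rewrite eq_le; apply/andP; split.
  case: (ltngtP (idx s) (idx t)) => st.
  - apply: le_trans (cayley_dist_le_ends _ _ true false) _; rewrite endE.
    have : (idx s).+1%:R <= (idx t)%:R :> R by rewrite ler_nat.
    rewrite addn1 addn0 => st'; rewrite (distrC s t) (distrC s).
    rewrite (distrC (idx s).+1%:R (idx t)%:R).
    by rewrite !ger0_norm ?subr_ge0 //; lra.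
  - apply: le_trans (cayley_dist_le_ends _ _ false true) _; rewrite endE.
    have : (idx t).+1%:R <= (idx s)%:R :> R by rewrite ler_nat.
    rewrite addn1 addn0 => st'; rewrite (distrC t).
    by rewrite !ger0_norm ?subr_ge0; lra.
  - apply: le_trans (cayley_dist_le_edge _ _) _; rewrite /= ?st //.
    by rewrite sE tE st opprB addrA subrK.
apply: cayley_dist_lb => [e e'||].
- rewrite endE (distrC t); apply: le_trans (ler_distD (idx t + e')%N%:R _ _) _.
  by rewrite lerD2r ler_distD.
- move=> /= /c_inj ts _; have {}ts : idx t = idx s by apply: ts; lia.
  by rewrite sE tE ts opprB addrA subrK.
(* The second edge would be the first one reversed, and [c] would take the same value at [idx s] and
   at [idx s + 2]. *)
- rewrite /cp_tip /= labP // => /c_inj ts /opposite_val e.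
  have {}ts : idx t = (idx s).+1 by apply: ts; lia.
  have := labP tin; rewrite e ts -(labP sin) mulgK => /c_inj; lia.
Qed.

Lemma real_path_start p : cp_base p = c 0%N -> cp_pos p = 0 ->
  cayley_dist p (real_path 0) = 0.
Proof.
move=> pc p0; apply/eqP; rewrite eq_le cayley_dist_ge0 andbT.
apply: le_trans (cayley_dist_le_ends _ _ false false) _.
rewrite /= pc p0 /pos /idx truncn0 min0n subrr maxxx vertex_distE word_distxx //.
by rewrite minElt ltr10 !addr0.
Qed.

Lemma real_path_stop p : cp_base p = c n -> cp_pos p = 0 ->
  cayley_dist (real_path n%:R) p = 0.
Proof.
move=> pc p0; apply/eqP; rewrite eq_le cayley_dist_ge0 andbT.
case: (posnP n) => n0.
  apply: le_trans (cayley_dist_le_ends _ _ false false) _.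
  rewrite /= pc p0 /pos /idx n0 truncn0 min0n subrr maxxx vertex_distE word_distxx //.
  by rewrite minElt ltr10 !addr0.
have nn : 0 <= (n%:R : R) <= n%:R by rewrite lexx ler0n.
have [_ _ n2] := natrN0 n0 nn.
have idn : ((idx n%:R).+1 = n)%N.
  by move: n2; rewrite ler_nat /idx; lia.
apply: le_trans (cayley_dist_le_ends _ _ true false) _.
have [-> ->] := real_path_end true n0 nn.
by rewrite /= pc p0 addn1 idn vertex_distE word_distxx // subrr normr0 !addr0.
Qed.

Lemma word_dist_real_path i : (i <= n)%N ->
  (word_dist sw (c i) (cp_base (real_path i%:R)) <= 1)%N.
Proof.
move=> lein; rewrite /= /idx natrK.
rewrite (discrete_geodesic_dist (word_distC word_val_sw size_sw_min) gc) //; lia.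
Qed.

End RealGeodesic.

Lemma geodesic_labels n c (a : alphabet K X) : alphabet_val a <> 1%g ->
  discrete_geodesic (word_dist sw) n c ->
  exists2 lab : nat -> alphabet K X, forall i, alphabet_val (lab i) <> 1%g &
    forall i, (i < n)%N -> (c i * alphabet_val (lab i))%g = c i.+1.
Proof.
move=> a1 gc; suff /choice[lab labP] : forall i, exists b : alphabet K X,
    alphabet_val b <> 1%g /\ ((i < n)%N -> (c i * alphabet_val b)%g = c i.+1).
  by exists lab => i; case: (labP i).
move=> i; case: (ltnP i n) => lt; last by exists a.
have /word_dist1_label[b [cb b1]] : word_dist sw (c i) (c i.+1) = 1%N.
  by rewrite gc; lia.
by exists b.
Qed.

Lemma hyperbolic_discretely_slim delta (D : nat) :
  hyperbolic (@cayley_dist R G S K X) delta -> delta + 3 <= D%:R ->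
  discretely_slim (word_dist sw) D.
Proof.
move=> hyp leD n c z u gc bu.
have dC := word_distC word_val_sw size_sw_min.
have dT := word_dist_triangle word_val_sw size_sw_min.
have dG := word_dist_geodesic word_val_sw size_sw_min.
have dxx := word_distxx size_sw_min.
(* Points of the Cayley graph live on edges that are not loops, and there may be none if all
   vertices in sight coincide. Otherwise the first edge of [c1] yields a nontrivial label [a], used
   to represent vertices and as a filler label. *)
case: (posnP (word_dist sw (c n) z)) => nz.
  right; exists n => //; move: bu; rewrite /between nz dC; lia.
have [c1 [gc1 c10 c1n c1u]] := geodesic_through dT dG bu.
have [c2 [gc2 c20 c2n]] := dG z (c 0%N).
have /word_dist1_label[a [_ a1]] : word_dist sw (c1 0%N) (c1 1%N) = 1%N.
  by rewrite gc1; lia.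
have [l1 l11 l1P] := geodesic_labels a1 gc1.
have [l2 l21 l2P] := geodesic_labels a1 gc2.
have [l3 l31 l3P] := geodesic_labels a1 gc.
have p01 : 0 <= (0 : R) <= 1 by rewrite lexx ler01.
pose P g : point := CayleyPoint g a1 p01.
have geo m b l (l1' : forall i, alphabet_val (l i) <> 1%g) :
    discrete_geodesic (word_dist sw) m b ->
    (forall i, (i < m)%N -> (b i * alphabet_val (l i))%g = b i.+1) ->
    geodesic (@cayley_dist R G S K X) (P (b 0%N)) (P (b m)) m%:R
      (real_path m b l1').
  move=> gb lP; split; first exact: ler0n.
  - exact: real_path_start.
  - exact: real_path_stop.
  - by move=> s t sm tm; exact: real_path_dist.
have := geo _ _ _ l11 gc1 l1P; have := geo _ _ _ l21 gc2 l2P.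
have := geo _ _ _ l31 gc l3P; rewrite c10 c1n c20 c2n => g3 g2 g1.
set k := word_dist sw (c n) u in c1u; set m := word_dist sw (c n) z in c1n gc1 l1P g1.
have km : (k <= m)%N by move: bu; rewrite /between -/k -/m; lia.
have kk : 0 <= (k%:R : R) <= m%:R by rewrite ler0n ler_nat.
(* Of the 3 in [delta + 3], 2 is lost between points and bases of their edges, and 1 because the
   base of [real_path] at [k] may be a neighbour of [u]. *)
have near p : cayley_dist (real_path m c1 l11 k%:R) p <= delta ->
    (word_dist sw u (cp_base p) <= D)%N.
  move=> le; rewrite -(ler_nat R); apply: le_trans leD.
  have := word_dist_base_le (real_path m c1 l11 k%:R) p.
  have := dT (cp_base (real_path m c1 l11 k%:R)) u (cp_base p).
  have := word_dist_real_path gc1 l11 km; rewrite c1u.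
  by rewrite -!(ler_nat R) natrD; lra.
case: (hyp _ _ _ _ _ _ _ _ _ g1 g2 g3 _ kk) => -[s _ /near le].
  left; have [j jn e] := real_path_base (word_dist sw z (c 0%N)) c2 l21 s.
  exists (c2 j); last by rewrite -e.
  by have := discrete_geodesic_between gc2 jn; rewrite c20 c2n.
right; have [j jn e] := real_path_base n c l31 s.
by exists j => //; rewrite -e.
Qed.

End CayleyGraph.

(** * The extension *)

Section Extension.
Variables (R : realType) (G : groupType) (S : pred G) (K : subGroupType S).
Variable X : set G.
Local Notation word := (seq (letter K X)).
Local Notation word_val := (@word_val G S K X).
Local Notation word_dist := (@word_dist G S K X).
Variable sw : G -> word.
Hypothesis word_val_sw : forall g, word_val (sw g) = g.
Hypothesis size_sw_min : forall w, (size (sw (word_val w)) <= size w)%N.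
Implicit Types (u v w t : word) (g h s x : G).

Local Notation geodesic_word := (@geodesic_word G S K X sw).
Let dC := word_distC word_val_sw size_sw_min.
Let dT := word_dist_triangle word_val_sw size_sw_min.
Let dG := word_dist_geodesic word_val_sw size_sw_min.
Let dxx := word_distxx size_sw_min.

Variable D : nat.
Hypothesis slim : discretely_slim (word_dist sw) D.

Let L : nat := (8 * D + 2)%N.

Variables (phi : K -> R) (D0 : R).
Hypothesis phiV : forall k, phi k^-1%g = - phi k.
Hypothesis phiM : forall k k', `|phi k + phi k' - phi (k * k')%g| <= D0.

Definition word_phi w : R := phi (word_eta w).

Lemma defect_bound_ge0 : 0 <= D0.
Proof. exact: le_trans (normr_ge0 _) (phiM 1%g 1%g). Qed.

Lemma word_phi_cat u v :
  word_phi u + word_phi v - D0 <= word_phi (u ++ v) <= word_phi u + word_phi v + D0.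
Proof.
have := phiM (word_eta u) (word_eta v); rewrite /word_phi word_eta_cat ler_norml.
by move=> H; lra.
Qed.

Lemma word_phi_inv w : word_phi (invw w) = - word_phi w.
Proof. by rewrite /word_phi word_eta_inv phiV. Qed.

Lemma word_controlled f w n : controlled_by X phi f -> word_val w = 1%g ->
  (size w <= n)%N -> - f n <= word_phi w <= f n.
Proof.
move=> cf w1 wn; have [a [ta ea la]] := normal_form_of_word w.
rewrite -ler_norml /word_phi -ea; apply: cf; first by rewrite ta.
exact: leq_trans la wn.
Qed.

(** The word [u ++ invw v] is closed, and by antisymmetry its value is that of [u] minus that of
    [v], up to [D0]. *)
Lemma word_phi_diff f u v n : controlled_by X phi f -> word_val u = word_val v ->
  (size u + size v <= n)%N -> word_phi v - f n - D0 <= word_phi u.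
Proof.
move=> cf uv suv; have := @word_controlled f (u ++ invw v) n cf.
rewrite word_val_cat word_val_inv uv mulgV size_cat size_invw => /(_ erefl suv).
by have := word_phi_cat u (invw v); rewrite word_phi_inv; lra.
Qed.

(** Two concatenations on either side cost [4 * D0]; the fifth [D0] comes from [word_phi_diff]. *)
Lemma word_phi_replace f u v v' t n : controlled_by X phi f ->
  word_val v = word_val v' -> (size v + size v' <= n)%N ->
  word_phi (u ++ v ++ t) <= word_phi (u ++ v' ++ t) + f n + 5 * D0.
Proof.
move=> cf vv svv; have := word_phi_cat u (v ++ t); have := word_phi_cat v t.
have := word_phi_cat u (v' ++ t); have := word_phi_cat v' t.
by have := word_phi_diff cf (esym vv) (leq_trans (eq_leq (addnC _ _)) svv); lra.
Qed.

(** A closed local geodesic has the same ends as a constant geodesic, hence stays within [2 * D] of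
    its start; but its point number [L] is at distance [L = 8 * D + 2]. *)
Lemma closed_word_not_local_geodesic w : word_val w = 1%g -> (L <= size w)%N ->
  exists u v t, [/\ w = u ++ v ++ t, (size v <= L)%N & ~ geodesic_word v].
Proof.
move=> w1 Lw; apply: contrapT => H.
have lw u v t : w = u ++ v ++ t -> (size v <= L)%N -> geodesic_word v.
  by move=> e vL; apply: contrapT => nv; apply: H; exists u, v, t.
have lp := word_path_local_geodesic 1%g lw.
have gc : discrete_geodesic (word_dist sw) 0 (fun=> 1%g).
  by move=> i j ij; rewrite dxx; lia.
have [] := @local_geodesic_near _ _ dxx dC dT dG D slim L _ _ _ _ _ lp gc _ _ L Lw.
- by rewrite /L.
- exact: word_path0.
- by rewrite word_path_size w1 mulg1.
move=> j _; rewrite dC -[X in word_dist sw X _](word_path0 1%g w) lp;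
  rewrite /L in Lw *; lia.
Qed.

(* Dehn's algorithm. *)
Lemma controlled_linearly_controlled : controlled X phi ->
  exists2 C0 : R, 0 < C0 & linearly_controlled X phi C0.
Proof.
case=> f cf; have D0ge0 := defect_bound_ge0.
have f0 : 0 <= f (2 * L)%N.
  by have := @word_controlled f [::] (2 * L)%N cf (word_val_nil K X) (leq0n _); lra.
(* Shortening a subword of length at most [L] changes [word_phi] by less than [A], so a single
   deleted letter pays for it. *)
set A := f (2 * L)%N + 5 * D0 + 1.
have [A0 Af] : 0 < A /\ A = f (2 * L)%N + 5 * D0 + 1 by rewrite /A; split; lra.
move: A A0 Af => A A0 Af.
have bound n w : (size w <= n)%N -> word_val w = 1%g ->
    word_phi w <= A * (size w)%:R + A.
  elim: n w => [|n IHn] w wn w1.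
    have := @word_controlled f w (2 * L)%N cf w1 (leq_trans wn (leq0n _)).
    have : 0 <= A * (size w)%:R by apply: mulr_ge0; rewrite ?ler0n // ltW.
    by lra.
  have [wL|Lw] := leqP (size w) L.
    have := @word_controlled f w (2 * L)%N cf w1
      (leq_trans wL (leq_pmull _ (isT : (0 < 2)%N))).
    have : 0 <= A * (size w)%:R by apply: mulr_ge0; rewrite ?ler0n // ltW.
    by lra.
  have [u [v [t [e vL nv]]]] := closed_word_not_local_geodesic w1 (ltnW Lw).
  pose v' := sw (word_val v).
  have v'v : (size v' < size v)%N.
    rewrite ltn_neqAle size_sw_min andbT; apply/eqP => e'; apply: nv.
    by rewrite /geodesic_word /word_dist invg1 mul1g.
  have w'1 : word_val (u ++ v' ++ t) = 1%g.
    by rewrite -w1 e !word_val_cat word_val_sw.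
  have sw' : (size (u ++ v' ++ t) < size w)%N by rewrite e !size_cat; lia.
  have := IHn _ (leq_trans sw' wn) w'1.
  have := @word_phi_replace f u v v' t (2 * L)%N cf (esym (word_val_sw _)).
  have /[swap] /[apply] : (size v + size v' <= 2 * L)%N by lia.
  have : A * (size (u ++ v' ++ t)).+1%:R <= A * (size w)%:R.
    by apply: ler_wpM2l; rewrite ?ler_nat // ltW.
  by rewrite -natr1 -e; lra.
exists A => //.
move=> n a ta an; have ta' : word_val (nform a) = 1%g := ta.
have An : A * (size (nform a))%:R <= A * n%:R.
  by apply: ler_wpM2l; rewrite ?ler_nat // ltW.
(* The lower bound is the upper bound for the inverse word. *)
have := bound _ _ (leqnn _) ta'; have := bound _ (invw (nform a)) (leqnn _).
rewrite word_val_inv ta' invg1 size_invw word_phi_inv => /(_ erefl) H1 H2.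
rewrite ler_norml -[phi _]/(word_phi (nform a)); lra.
Qed.

(** * Words of nearly minimal cost *)

Variable C0 : R.
Hypothesis C0_gt0 : 0 < C0.
Hypothesis phi_linear : linearly_controlled X phi C0.

Let E : R := C0 + D0.
(** Large enough that one saved letter outweighs the loss [C0 * (2 * L) + C0 + 5 * D0] of a
    replacement and the slack [E] of near-minimality. *)
Let C : R := (2 * L + 8)%N%:R * E.

Let E_gt0 : 0 < E.
Proof. exact: ltr_wpDr defect_bound_ge0 C0_gt0. Qed.

Let C_ge : C0 + 7 * E <= C.
Proof.
have := defect_bound_ge0; rewrite /C natrD mulrDl => D0ge0.
have : 0 <= (2 * L)%N%:R * E by rewrite mulr_ge0 // ltW.
by move: E_gt0 C0_gt0; rewrite /E; lra.
Qed.

Definition cost w : R := C * (size w)%:R + word_phi w.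

Lemma cost_cat u v : cost u + cost v - D0 <= cost (u ++ v) <= cost u + cost v + D0.
Proof. by have := word_phi_cat u v; rewrite /cost size_cat natrD mulrDr; lra. Qed.

(** By linear control each letter of [w] lowers [word_phi] by at most [C0], which the term [C] per
    letter makes up for. *)
Lemma cost_sw g w : word_val w = g ->
  cost w >= word_phi (sw g) - C0 * (size (sw g))%:R - E.
Proof.
move=> wg; have := word_phi_diff phi_linear (etrans wg (esym (word_val_sw g))) (leqnn _).
rewrite natrD /cost /E => H; have D0ge0 := defect_bound_ge0.
have : 0 <= (C - C0) * (size w)%:R.
  by rewrite mulr_ge0 // subr_ge0; move: C_ge E_gt0; lra.
by lra.
Qed.

(** There may be infinitely many words for [g] and the infimum need not be attained, hence the slack
    [E]. *)
Lemma cheap_words_exist : exists m : G -> word,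
  (forall g, word_val (m g) = g) /\ forall w, cost (m (word_val w)) <= cost w + E.
Proof.
suff /choice[m mP] : forall g, exists w, word_val w = g /\
    forall w', word_val w' = g -> cost w <= cost w' + E.
  exists m; split=> [g|w]; first by case: (mP g).
  by case: (mP (word_val w)) => _; apply.
move=> g; pose V := [set cost w | w in [set w | word_val w = g]].
have lbV : has_lbound V.
  by exists (word_phi (sw g) - C0 * (size (sw g))%:R - E) => _ [w wg <-]; exact: cost_sw.
have infV : has_inf V by split=> //; exists (cost (sw g)), (sw g).
have [_ [w wg <-] lt] := inf_adherent E_gt0 infV.
exists w; split=> // w' w'g; apply: le_trans (ltW lt) _; rewrite lerD2r.
by apply: ge_inf => //; exists w'.
Qed.

Variable m : G -> word.
Hypothesis word_val_m : forall g, word_val (m g) = g.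
Hypothesis cost_m : forall w, cost (m (word_val w)) <= cost w + E.

Definition min_cost g : R := cost (m g).
Local Notation F := min_cost.

Lemma min_costM g h : F (g * h)%g <= F g + F h + 2 * E.
Proof.
have := cost_m (m g ++ m h); rewrite word_val_cat !word_val_m /min_cost.
by move: (cost_cat (m g) (m h)) C0_gt0; rewrite /E; lra.
Qed.

Lemma min_cost_split g u v : m g = u ++ v ->
  F (word_val u) + F (word_val v) <= F g + 3 * E.
Proof.
move=> e; have := cost_m u; have := cost_m v; have := cost_cat u v.
by move: C0_gt0; rewrite -e /min_cost /E; lra.
Qed.

(** Each summand may be large through [phi], but on a shortest word and its inverse these parts
    cancel. *)
Lemma min_cost_inv s : F s + F s^-1%g <= 2 * (C * (size (sw s))%:R) + 2 * E.
Proof.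
have := cost_m (sw s); have := cost_m (invw (sw s)).
rewrite word_val_inv word_val_sw /min_cost /(cost (sw _)) /(cost (invw _)).
by rewrite size_invw word_phi_inv; lra.
Qed.

(* A non-geodesic subword of length at most L could be shortened, which saves
   C and changes word_phi by less than C - E. *)
Lemma cheap_word_local_geodesic g u v t : m g = u ++ v ++ t ->
  (size v <= L)%N -> geodesic_word v.
Proof.
move=> e vL; apply: contrapT => nv; pose v' := sw (word_val v).
have v'v : (size v' < size v)%N.
  rewrite ltn_neqAle size_sw_min andbT; apply/eqP => e'; apply: nv.
  by rewrite /geodesic_word /word_dist invg1 mul1g.
have := cost_m (u ++ v' ++ t); rewrite !word_val_cat word_val_sw -!word_val_cat -e.
rewrite word_val_m e /cost.
have := @word_phi_replace _ u v' v t (2 * L)%N phi_linear (word_val_sw _).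
have /[swap] /[apply] : (size v' + size v <= 2 * L)%N by lia.
have : C * (size (u ++ v' ++ t)).+1%:R <= C * (size (u ++ v ++ t))%:R.
  apply: ler_wpM2l; last by rewrite ler_nat !size_cat; lia.
  by move: C_ge E_gt0 C0_gt0; lra.
have CE : C = (2 * L)%N%:R * E + 8 * E by rewrite /C natrD mulrDl.
have EE : E = C0 + D0 by [].
rewrite -natr1; have : C0 * (2 * L)%N%:R <= (2 * L)%N%:R * E.
  by rewrite mulrC ler_wpM2l // /E; have := defect_bound_ge0; lra.
by move: defect_bound_ge0 C0_gt0; lra.
Qed.

(** The price of a detour of length at most [6 * D + 1], the distance in [geodesic_near_local],
    there and back; [9 * E] absorbs the additive errors. *)
Let B : R := 2 * (C * (6 * D + 1)%N%:R) + 9 * E.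

Let B_ge : 9 * E <= B.
Proof.
have : 0 <= C * (6 * D + 1)%N%:R by rewrite mulr_ge0 //; move: C_ge E_gt0 C0_gt0; lra.
by rewrite /B; lra.
Qed.

Let min_cost_short s : (size (sw s) <= 6 * D + 1)%N ->
  F s + F s^-1%g <= B - 7 * E.
Proof.
move=> short; apply: le_trans (min_cost_inv s) _.
have : C * (size (sw s))%:R <= C * (6 * D + 1)%N%:R.
  by apply: ler_wpM2l; rewrite ?ler_nat //; move: C_ge E_gt0 C0_gt0; lra.
by rewrite /B; lra.
Qed.

(** By subadditivity, inserting or removing [s] and [s^-1] costs at most [F s + F s^-1] and some
    multiples of [E]. *)
Lemma min_cost_move g h s : (word_dist sw 1 s <= 6 * D + 1)%N ->
  `|F (g * s)%g + F (s^-1 * h)%g - (F g + F h)| <= B.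
Proof.
rewrite /word_dist invg1 mul1g => /min_cost_short short.
have := min_costM g s; have := min_costM s^-1 h.
have := min_costM (g * s) s^-1; have := min_costM s (s^-1 * h).
by rewrite mulgK mulVKg ler_norml; move: E_gt0; lra.
Qed.

(** One inequality is [min_costM]. For the other, the path of [m g] is a local geodesic and passes
    through some [a] near [x]; cutting [m g] at [a] is nearly additive, and a short detour moves the
    cut from [a] to [x]. *)
Lemma min_cost_geodesic g x : between (word_dist sw) 1%g g x ->
  `|F g - (F x + F (x^-1 * g)%g)| <= B.
Proof.
move=> bx; have [c [gc c0 cn cx]] := geodesic_through dT dG bx.
have lp := word_path_local_geodesic 1%g
  (@cheap_word_local_geodesic g).
have xn : (word_dist sw 1 x <= word_dist sw 1 g)%N by move: bx; rewrite /between; lia.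
have [] := @geodesic_near_local _ _ dxx dC dT dG D slim L _ _ _ _ _ lp gc _ _ _ xn.
- by rewrite /L.
- by rewrite word_path0.
- by rewrite word_path_size word_val_m mul1g.
move=> i _; rewrite cx /word_path mul1g; set a := word_val (take i (m g)).
rewrite /word_dist => /min_cost_short short.
have := min_cost_split (esym (cat_take_drop i (m g))).
have -> : word_val (drop i (m g)) = (a^-1 * g)%g.
  by rewrite -[g in RHS]word_val_m -(cat_take_drop i (m g)) word_val_cat mulKg
    cat_take_drop.
rewrite -/a => split_a; move: short.
have := min_costM a (x^-1 * a)^-1; have := min_costM (x^-1 * a) (a^-1 * g).
have := min_costM x (x^-1 * g).
have -> : (a * (x^-1 * a)^-1 = x)%g by rewrite invgM invgK mulVKg.
rewrite -mulgA !mulVKg ler_norml.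
by move: E_gt0 B_ge; lra.
Qed.

(** * Antisymmetrization and the extension *)

Definition anti_cost g : R := (F g - F g^-1%g) / 2.
Local Notation P := anti_cost.

Lemma anti_costV g : P g^-1%g = - P g.
Proof. by rewrite /anti_cost invgK; lra. Qed.

Lemma anti_cost_move g h s : (word_dist sw 1 s <= 6 * D + 1)%N ->
  `|P (g * s)%g + P (s^-1 * h)%g - (P g + P h)| <= B.
Proof.
move=> short; have := min_cost_move g h short; have := min_cost_move h^-1 g^-1 short.
by rewrite /anti_cost !invgM invgK !ler_norml; lra.
Qed.

Lemma anti_cost_geodesic g x : between (word_dist sw) 1%g g x ->
  `|P g - (P x + P (x^-1 * g)%g)| <= B.
Proof.
move=> bx; have := min_cost_geodesic bx.
(* The same geodesic read backwards and translated by [g^-1]. *)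
have /min_cost_geodesic : between (word_dist sw) 1%g g^-1%g (g^-1 * x)%g.
  have e : word_dist sw 1 g^-1 = word_dist sw g 1.
    by rewrite -[g^-1%g]mulg1 word_distVr mulg1.
  rewrite /between word_distVr word_distVl mulg1 mulgV e.
  by rewrite (dC x) !(dC g) addnC.
by rewrite /anti_cost !invgM !invgK mulgK !ler_norml; lra.
Qed.

(** The three sides are cut at the tripod points [u], [v], [w], and the cuts at [v] and [w] are
    moved to [u], where the two copies of [P (u^-1 * g)] cancel by antisymmetry. Three cuts and two
    moves cost [B] each. *)
Lemma anti_cost_quasimorphism g h : `|P g + P h - P (g * h)%g| <= 5 * B.
Proof.
have [u [v [w [bu bv bw duv duw]]]] := slim_tripod dxx dC dT dG slim 1%g g (g * h)%g.
have := anti_cost_geodesic bu; have := anti_cost_geodesic bw.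
have /anti_cost_geodesic : between (word_dist sw) 1%g h (g^-1 * v)%g.
  by rewrite /between word_distVr word_distVl -[h in RHS](mulKg g) word_distVr mulg1.
have short y : (word_dist sw u y <= D + 1)%N ->
    (word_dist sw 1 (u^-1 * y)%g <= 6 * D + 1)%N.
  by rewrite word_distVr mulg1; lia.
have uE y k : ((u^-1 * y)^-1 * (u^-1 * k) = y^-1 * k)%g.
  by rewrite invgM invgK -mulgA mulVKg.
have := anti_cost_move u (u^-1 * (g * h)) (short w (leq_trans duw (leq_addr _ _))).
have := anti_cost_move (u^-1 * g)^-1 (u^-1 * (g * h)) (short v duv).
rewrite !uE mulVKg (anti_costV (u^-1 * g)) invgM invgK -mulgA.
by rewrite !ler_norml; lra.
Qed.

(** One-letter words bound [F] from above at [k] and at its inverse. As the two values add up to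
    nearly at least [F 1], each upper bound gives a lower bound for the other. *)
Lemma anti_cost_near_phi (k : K) : `|P (val k) - phi k| <= C + 4 * E.
Proof.
have F_le (k' : K) : F (val k') <= C + phi k' + E.
  have := cost_m [:: inl k']; rewrite /cost /word_phi /word_val /word_eta !big_seq1.
  by rewrite mulr1.
have := F_le k; have := F_le k^-1%g; rewrite gmulfV phiV.
have := min_costM (val k) (val k)^-1; rewrite mulgV.
have : F 1%g >= - E.
  have := cost_sw (word_val_m 1%g); have := size_sw_min [::]; rewrite word_val_nil leqn0.
  move=> /nilP ->; rewrite /word_phi /word_eta big_nil.
  have : phi 1%g = 0 by have := phiV 1%g; rewrite invg1; lra.
  by move=> ->; rewrite /min_cost /=; lra.
by rewrite /anti_cost ler_norml; move: E_gt0; lra.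
Qed.

Definition extension g : R := if insub g is Some k then phi k else P g.

Lemma extension_val (k : K) : extension (val k) = phi k.
Proof. by rewrite /extension valK. Qed.

Lemma extension_near g : `|extension g - P g| <= C + 4 * E.
Proof.
rewrite /extension; case: insubP => [k _ <-|_].
  by rewrite distrC anti_cost_near_phi.
by rewrite subrr normr0; move: C_ge E_gt0 C0_gt0; lra.
Qed.

Lemma extensionV g : extension g^-1%g = - extension g.
Proof.
rewrite {2}/extension; case: insubP => [k _ <-|ng].
  by rewrite -gmulfV extension_val phiV.
rewrite /extension; case: insubP => [k kS kg|_]; last exact: anti_costV.
by case/negP: ng; rewrite -[g]invgK -kg -gmulfV; exact: valP.
Qed.

Lemma extension_quasimorphism g h :
  `|extension g + extension h - extension (g * h)%g| <= 5 * B + 3 * (C + 4 * E).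
Proof.
have := anti_cost_quasimorphism g h; have := extension_near g.
by have := extension_near h; have := extension_near (g * h); rewrite !ler_norml; lra.
Qed.

Lemma linearly_controlled_extension :
  exists Phi : G -> R, [/\ Qas R G Phi, extends Phi phi &
    defect Phi <= ((2 * L + 8) * (10 * (6 * D + 1) + 3) + 57)%N%:R * (C0 + D0)].
Proof.
(* The 57 collects [9 * E] from each of five [B] and [4 * E] from each of three replacements of
   [P]. *)
have -> : ((2 * L + 8) * (10 * (6 * D + 1) + 3) + 57)%N%:R * (C0 + D0) =
    5 * B + 3 * (C + 4 * E).
  by rewrite /B /C /E natrD natrM (natrD _ (10 * _)) (natrM _ 10); ring.
have ub : ubound (defect_set extension) (5 * B + 3 * (C + 4 * E)).
  by move=> _ [[g h] _ <-]; exact: extension_quasimorphism.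
exists extension; split; last 1 first.
- apply: sup_le_ub => //; exists `|extension 1 + extension 1 - extension (1 * 1)%g|.
  by exists (1%g, 1%g).
- by split; [exists (5 * B + 3 * (C + 4 * E))|exact: extensionV].
- exact: extension_val.
Qed.

End Extension.

Theorem theorem1p3 (R : realType) (delta : R) (hdelta : 0 <= delta) :
  exists M : R,
  forall (G : groupType) (S : pred G) (K : subGroupType S) (X : set G),
    symmetric_set X ->
    relative_generating_set K X ->
    hyperbolic (@cayley_dist R G S K X) delta ->
  forall phi : K -> R, Qas R K phi ->
    (controlled X phi ->
       exists Phi : G -> R, Qas R G Phi /\ extends Phi phi) /\
    (forall C0 : R, 0 < C0 -> linearly_controlled X phi C0 ->
       exists Phi : G -> R,
         [/\ Qas R G Phi, extends Phi phi
           & defect Phi <= M * C0 + M * defect phi]).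
Proof.
(* An integer above [delta + 3] that depends on [delta] alone, and therefore so does [M]. *)
pose D := (Num.truncn (delta + 3)).+1.
have leD : delta + 3 <= D%:R by apply/ltW/truncnS_gt.
exists ((2 * (8 * D + 2) + 8) * (10 * (6 * D + 1) + 3) + 57)%N%:R.
move=> G S K X symX gen hyp phi [qphi phiV].
have [sw [swE sw_min]] := shortest_words_exist gen.
have slim := hyperbolic_discretely_slim symX swE sw_min hyp leD.
have phiM k k' : `|phi k + phi k' - phi (k * k')%g| <= defect phi.
  by apply: sup_ubound => //; exists (k, k').
have ext C0 : 0 < C0 -> linearly_controlled X phi C0 -> exists Phi : G -> R,
    [/\ Qas R G Phi, extends Phi phi & defect Phi <=
    ((2 * (8 * D + 2) + 8) * (10 * (6 * D + 1) + 3) + 57)%N%:R * (C0 + defect phi)].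
  move=> C0_gt0 lin.
  have [m [mE m_min]] := cheap_words_exist swE D phiV phiM C0_gt0 lin.
  exact: (linearly_controlled_extension swE sw_min slim phiV phiM C0_gt0 lin mE m_min).
split=> [ctl|C0 C0_gt0 lin].
  have [C0 C0_gt0 lin] := controlled_linearly_controlled swE sw_min slim phiV phiM ctl.
  by have [Phi [qPhi ePhi _]] := ext _ C0_gt0 lin; exists Phi.
by have [Phi [qPhi ePhi dPhi]] := ext _ C0_gt0 lin; exists Phi; split; rewrite // -mulrDr.
Qed.
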